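(* For any $\Phi\in\mathcal G^*$, we have $D_t\Phi\in\mathcal G^*$ for almost all $t\in\mathbb R$. Moreover, if for some $\lambda>0$ we have $\Phi\in\mathcal G_{-\lambda}$, then for any $\varepsilon>0$ there is a constant $C_\varepsilon$ such that $$\int_{\mathbb R}\|D_t\Phi\|^2_{-\lambda-\varepsilon}\,dt\le C_\varepsilon\|\Phi\|^2_{-\lambda}<\infty,$$ and in consequence $D_t\Phi\in\mathcal G_{-\lambda-\varepsilon}$ for almost all $t\in\mathbb R$.
   Context: Let $\mu$ be the Gaussian white noise measure on the space of tempered distributions $\mathcal S'(\mathbb R)$, i.e. $\int e^{i\langle x,\xi\rangle}\,d\mu(x)=e^{-\frac12|\xi|^2_{L^2(\mathbb R)}}$ for $\xi\in\mathcal S(\mathbb R)$, and let $(L^2)=L^2(\mathcal S'(\mathbb R),\mu)$. Every $\phi\in(L^2)$ has a unique chaos expansion $\phi=\sum_{n\ge0}I_n(\phi^{(n)})$ with symmetric $\phi^{(n)}\in L^2(\mathbb R^n)$, where $I_n$ is the $n$-fold iterated Wiener integral. For $\lambda\in\mathbb R$ put $\|\phi\|_\lambda^2=\sum_{n\ge0}n!\,e^{2\lambda n}|\phi^{(n)}|^2_{L^2(\mathbb R^n)}$, and let $\mathcal G_\lambda$ be the space of (for $\lambda<0$: formal) chaos series $\sum_nI_n(\phi^{(n)})$ with symmetric kernels $\phi^{(n)}\in L^2(\mathbb R^n)$ and $\|\phi\|_\lambda<\infty$. $\mathcal G=\bigcap_{\lambda>0}\mathcal G_\lambda$ and its dual is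 $\mathcal G^*=\bigcup_{\lambda>0}\mathcal G_{-\lambda}$. For $\Phi=\sum_{n\ge0}I_n(\Phi^{(n)})\in\mathcal G^*$ the stochastic derivative at $t$ is $D_t\Phi=\sum_{n\ge1}n\,I_{n-1}(\Phi^{(n)}(\cdot,t))$. *)

(* Defs.v *)
From HB Require Import structures.
From mathcomp Require Import all_boot all_order all_algebra all_fingroup.
From mathcomp Require Import all_classical all_reals all_analysis.
From mathcomp Require Import measurable_realfun.

Set Implicit Arguments.
Unset Strict Implicit.
Unset Printing Implicit Defensive.
Import Order.TTheory GRing.Theory Num.Theory.
Import numFieldNormedType.Exports.

Local Open Scope classical_set_scope.
Local Open Scope ring_scope.

Section lebesgue_tuple.
Context {R : realType}.

Definition tuple_snoc n (p : n.-tuple R * R) : n.+1.-tuple R :=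
  [tuple of rcons p.1 p.2].

Lemma measurable_tuple_snoc n : measurable_fun setT (@tuple_snoc n).
Proof.
apply/measurable_fun_tnthP => i.
case: (ltnP i n) => ni.
  rewrite (_ : _ \o _ = (fun x => tnth x (Ordinal ni)) \o fst).
    exact: (measurableT_comp (measurable_tnth _) measurable_fst).
  by apply/funext => p /=; rewrite !(tnth_nth 0)/= nth_rcons size_tuple ni.
rewrite (_ : _ \o _ = snd); first exact: measurable_snd.
apply/funext => p /=; rewrite (tnth_nth 0)/= nth_rcons size_tuple.
have -> : (i : nat) = n by apply/eqP; rewrite eqn_leq ni -ltnS ltn_ord.
by rewrite ltnn eqxx.
Qed.

Definition tuple_unsnoc n (x : n.+1.-tuple R) : n.-tuple R * R :=
  ([tuple tnth x (widen_ord (leqnSn n) i) | i < n], tnth x ord_max).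

Lemma tuple_unsnocK n : cancel (@tuple_unsnoc n) (@tuple_snoc n).
Proof.
move=> x; apply: eq_from_tnth => i.
rewrite (tnth_nth 0)/= nth_rcons size_map size_enum_ord.
case: ltnP => ni.
  rewrite -[i in nth _ _ i]/(nat_of_ord (Ordinal ni)) -(tnth_nth 0 (mktuple _)).
  by rewrite tnth_mktuple; congr tnth; exact: val_inj.
have ein : (i : nat) = n by apply/eqP; rewrite eqn_leq ni -ltnS ltn_ord.
by rewrite ein eqxx; congr tnth; apply: val_inj.
Qed.

Lemma tuple_snocK n : cancel (@tuple_snoc n) (@tuple_unsnoc n).
Proof.
move=> [x t]; congr pair.
  apply: eq_from_tnth => i.
  by rewrite tnth_mktuple !(tnth_nth 0)/= nth_rcons size_tuple ltn_ord.
by rewrite (tnth_nth 0)/= nth_rcons size_tuple ltnn eqxx.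
Qed.

Lemma measurable_tuple_unsnoc n : measurable_fun setT (@tuple_unsnoc n).
Proof.
apply/measurable_fun_pair; last exact: measurable_tnth.
apply/measurable_fun_tnthP => i.
rewrite (_ : _ \o _ = (fun x => tnth x (widen_ord (leqnSn n) i))).
  exact: measurable_tnth.
by apply/funext => x /=; rewrite tnth_mktuple.
Qed.

Section step.
Variables (n : nat) (mu : {sigma_finite_measure set (n.-tuple R) -> \bar R}).

Definition snoc_measure : set (n.+1.-tuple R) -> \bar R :=
  pushforward (mu \x @lebesgue_measure R)%E (@tuple_snoc n).

Let snoc_measure0 : snoc_measure set0 = 0%E.
Proof. by rewrite /snoc_measure /pushforward preimage_set0 measure0. Qed.

Let snoc_measure_ge0 A : (0 <= snoc_measure A)%E.
Proof. by rewrite /snoc_measure /pushforward; apply: integral_ge0. Qed.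

Let snoc_measure_sigma_additive : semi_sigma_additive snoc_measure.
Proof.
move=> F mF tF mUF; rewrite /snoc_measure /pushforward preimage_bigcup.
have mpre A : measurable A -> measurable (@tuple_snoc n @^-1` A).
  by move=> mA; rewrite -[X in measurable X]setTI; exact: measurable_tuple_snoc.
apply: measure_semi_sigma_additive.
- by move=> k; exact: mpre.
- apply/trivIsetP => /= i j _ _ ij; rewrite -preimage_setI.
  by move/trivIsetP : tF => /(_ i j Logic.I Logic.I ij) ->; rewrite preimage_set0.
- by rewrite -preimage_bigcup; exact: mpre.
Qed.

HB.instance Definition _ := isMeasure.Build _ _ _ snoc_measure
  snoc_measure0 snoc_measure_ge0 snoc_measure_sigma_additive.

Let snoc_measure_sigma_finite : sigma_finite setT snoc_measure.
Proof.
have /sigma_finiteP[F [TF ndF Foo]] := sigma_finiteT mu.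
have /sigma_finiteP[G [TG ndG Goo]] := sigma_finiteT (@lebesgue_measure R).
exists (fun k => @tuple_unsnoc n @^-1` (F k `*` G k)).
  apply/esym; rewrite -subTset => x _.
  have [i _ Fi] : (\bigcup_i F i) (tuple_unsnoc x).1 by rewrite -TF.
  have [j _ Gj] : (\bigcup_i G i) (tuple_unsnoc x).2 by rewrite -TG.
  exists (maxn i j) => //; split.
    by move: Fi; exact/subsetPset/ndF/leq_maxl.
  by move: Gj; exact/subsetPset/ndG/leq_maxr.
move=> k; have [mF Fk] := Foo k; have [mG Gk] := Goo k; split.
  rewrite -[X in measurable X]setTI; apply: measurable_tuple_unsnoc => //.
  exact: measurableX.
rewrite /snoc_measure /pushforward.
rewrite (_ : _ @^-1` _ = F k `*` G k); last first.
  by rewrite -comp_preimage (_ : _ \o _ = id)//; apply/funext; exact: tuple_snocK.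
by rewrite product_measure1E// lte_mul_pinfty// ge0_fin_numE.
Qed.

HB.instance Definition _ := Measure_isSigmaFinite.Build _ _ _ snoc_measure
  snoc_measure_sigma_finite.

End step.

(* Lebesgue measure on R^n: R^0 is a point of mass 1 and R^(n+1) = R^n x R *)
Fixpoint lebesgue_tuple n : {sigma_finite_measure set (n.-tuple R) -> \bar R} :=
  match n with
  | 0%N => \d_([tuple] : 0.-tuple R)
  | m.+1 => snoc_measure (lebesgue_tuple m)
  end.

Lemma lebesgue_tuple_box n (A : 'I_n -> set R) :
  (forall i, measurable (A i)) ->
  lebesgue_tuple n [set x | forall i, A i (tnth x i)] =
  (\prod_(i < n) @lebesgue_measure R (A i))%E.
Proof.
elim: n A => [|n IH] A mA.
  by rewrite big_ord0 /= diracE mem_set// => -[].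
rewrite big_ord_recr/= -(IH (fun i => A (widen_ord (leqnSn n) i)))//.
rewrite /snoc_measure /pushforward -product_measure1E//.
- congr (_ _); apply/seteqP; split => -[x t] /=.
    move=> xA; have xtK := tuple_snocK (x, t).
    by rewrite -[x]/(x, t).1 -[t]/(x, t).2 -xtK; split => [i|] /=;
      rewrite ?tnth_mktuple; exact: xA.
  move=> [xA tA] i; move: (tuple_snocK (x, t)) xA tA.
  move: (tuple_snoc _) => y [<- <-] yA tA.
  case: (unliftP ord_max i) => [j ->|->//].
  have := yA j; rewrite tnth_mktuple.
  by rewrite (_ : lift _ _ = widen_ord (leqnSn n) j)//; apply/val_inj/lift_max.
- rewrite (_ : mkset _ =
      \bigcap_(i in [set: 'I_n]) ((tnth (T:=R))^~ i @^-1` A (widen_ord (leqnSn n) i))).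
    apply: fin_bigcap_measurable => // i _.
    by rewrite -[X in measurable X]setTI; exact: measurable_tnth.
  by apply/seteqP; split => x /= xA i => [_|]; apply: xA.
- exact: mA.
Qed.

End lebesgue_tuple.

(* The formal chaos series \sum_n I_n(Phi n), encoded by representatives of its
   kernels: for negative weights the series need not converge in (L^2), so the
   multiple integrals I_n are only formal there. *)
Definition chaos_series (R : realType) := forall n, n.-tuple R -> R.

Section spaces.
Context {R : realType}.
Implicit Types (l t : R) (Phi : chaos_series R).

(* almost everywhere, since a kernel stands for a class in L^2(R^n) *)
Definition symmetric_kernel n (f : n.-tuple R -> R) : Prop :=
  forall s : 'S_n, {ae lebesgue_tuple n, forall x,
    f [tuple tnth x (s i) | i < n] = f x}.

Definition calG_norm2 l Phi : \bar R :=
  (\sum_(0 <= n <oo)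
     ((n`!)%:R * expR (2 * l * n%:R))%:E *
     'N[lebesgue_tuple n]_2%:E [EFin \o Phi n] ^+ 2)%E.

Definition calG l : set (chaos_series R) :=
  [set Phi | (forall n, Phi n \in Lfun (lebesgue_tuple n) 2%:E /\
                        symmetric_kernel (Phi n)) /\
             (calG_norm2 l Phi < +oo)%E].

Definition calG_dual : set (chaos_series R) :=
  \bigcup_(l in [set l : R | 0 < l]) calG (- l).

(* I_(n-1) is applied to n Phi^(n)(., t); hence the shift of the index here.
   Changing the representatives of the kernels of Phi changes those of the
   derivative, up to null sets, only for t in a null set. *)
Definition stoch_deriv t Phi : chaos_series R :=
  fun n x => n.+1%:R * Phi n.+1 (tuple_snoc (x, t)).

End spaces.

(* Main.v *)
Require Import Defs.
From mathcomp Require Import all_boot all_order all_algebra.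
From mathcomp Require Import all_classical all_reals all_analysis.
From mathcomp Require Import measurable_realfun.
From mathcomp Require Import perm.
From mathcomp Require Import ring lra.

(** The estimate is an identity term by term.  By Tonelli's theorem on
    R^(n+1) = R^n x R ([integral_lebesgue_tupleS]), integrating over [t] the
    squared L^2 norm of [(n+1) Phi^(n+1)(., t)] gives [(n+1)^2] times the
    squared norm of [Phi^(n+1)].  Since [n! (n+1)^2 = (n+1) (n+1)!], the n-th
    term of the squared [l - e]-norm of the derivative integrates to the
    (n+1)-st term of the squared [l]-norm of [Phi], up to the factor
    [(n+1) exp(- 2 e n) exp(- 2 l)].  An exponential beats the linear factor
    [n+1], so this is bounded uniformly in [n] ([chaos_weight_deriv_le]);
    summing, which monotone convergence allows, gives the bound on the integral
    ([integral_calG_norm2_stoch_deriv_le]).  It holds for [l] of either sign.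

    A nonnegative function with finite integral is finite almost everywhere,
    so for almost every [t] the derivative has finite norm, and then each of
    its kernels has a finite L^2 norm because all weights are positive.  What
    remains is the symmetry of the kernels.  A permutation of the first [n]
    variables is a permutation of all [n+1] that fixes the last one, and the
    null set on which the symmetry of [Phi^(n+1)] under it fails has null
    sections at almost every [t] ([ae_lebesgue_tupleS]); there are finitely
    many permutations and countably many [n], so one null set of [t] serves
    them all ([ae_calG_stoch_deriv]).  Membership in the dual space is the case
    [e = 1], with index [l + 1] in place of [l]. *)

Set Implicit Arguments.
Unset Strict Implicit.
Unset Printing Implicit Defensive.
Import Order.TTheory GRing.Theory Num.Theory.
Import numFieldNormedType.Exports.

Local Open Scope classical_set_scope.
Local Open Scope ring_scope.

(** * Fubini's theorem in the last variable *)

Section lebesgue_tuple_fubini.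
Context {R : realType} (n : nat).

Lemma measurable_snoc_section (t : R) :
  measurable_fun setT (fun x : n.-tuple R => tuple_snoc (x, t)).
Proof.
apply: (measurableT_comp (@measurable_tuple_snoc R n)).
exact/measurable_fun_pair.
Qed.

Section tonelli.
Variable f : n.+1.-tuple R -> \bar R.
Hypothesis mf : measurable_fun setT f.
Hypothesis f0 : forall x, (0 <= f x)%E.

(** [measurableTypeR R] is [R] with the sigma-algebra on which
    [lebesgue_measure] is defined, the one that enters the product measure. *)
Lemma measurable_integral_snoc :
  measurable_fun setT
    (fun t : measurableTypeR R =>
       \int[lebesgue_tuple n]_x f (tuple_snoc (x, t)))%E.
Proof.
apply: (@measurable_fun_fubini_tonelli_G _ _ _ _ _ _ (f \o @tuple_snoc R n)).
  apply: measurableT_comp mf _; exact: measurable_tuple_snoc.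
by move=> x; exact: f0.
Qed.

(** The measure [lebesgue_tuple n.+1] is by definition a pushforward of this
    form, so Tonelli's theorem for the product measure carries over to it. *)
Lemma integral_pushforward_snoc
    (m1 : {sigma_finite_measure set (n.-tuple R) -> \bar R})
    (m2 : {sigma_finite_measure set (measurableTypeR R) -> \bar R}) :
  (\int[pushforward (m1 \x m2) (@tuple_snoc R n)]_y f y =
   \int[m2]_t \int[m1]_x f (tuple_snoc (x, t)))%E.
Proof.
have ms :
    measurable_fun [set: n.-tuple R * measurableTypeR R] (@tuple_snoc R n).
  exact: measurable_tuple_snoc.
have Epush := @ge0_integral_pushforward _ _ _ _ R _ ms
  (m1 \x m2)%E _ _ measurableT mf (fun y _ => f0 y).
apply: (etrans Epush).
rewrite preimage_setT.
exact: (@fubini_tonelli2 _ _ _ _ R m1 m2 (f \o @tuple_snoc R n)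
  (measurableT_comp mf ms) (fun x => f0 _)).
Qed.

Lemma integral_lebesgue_tupleS :
  (\int[lebesgue_tuple n.+1]_y f y =
   \int[lebesgue_measure]_t \int[lebesgue_tuple n]_x f (tuple_snoc (x, t)))%E.
Proof.
have E := integral_pushforward_snoc (lebesgue_tuple n) (@lebesgue_measure R).
exact: E.
Qed.

End tonelli.

(** Tonelli for the indicator of a null set: the measures of its sections
    integrate to 0, hence almost all of them vanish. *)
Lemma ae_lebesgue_tupleS (P : n.+1.-tuple R -> Prop) :
  {ae lebesgue_tuple n.+1, forall y, P y} ->
  {ae lebesgue_measure, forall t : R,
     {ae lebesgue_tuple n, forall x, P (tuple_snoc (x, t))}}.
Proof.
move=> [N [mN N0 PN]].
have mI : measurable_fun setT (fun y : n.+1.-tuple R => (\1_N y : R)%:E).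
  exact/measurable_EFinP.
have I0 y : (0 <= (\1_N y : R)%:E)%E by rewrite lee_fin.
have mS := measurable_integral_snoc mI I0.
have : ae_eq lebesgue_measure setT
    (fun t : measurableTypeR R =>
       \int[lebesgue_tuple n]_x (\1_N (tuple_snoc (x, t)) : R)%:E)%E
    (cst 0%E).
  apply/(ae_eq_integral_abs _ measurableT mS).
  under eq_integral do rewrite gee0_abs ?integral_ge0//.
  rewrite -(integral_lebesgue_tupleS mI I0) integral_indic// setIT.
  exact: N0.
apply: filterS => t /(_ I) /= Nt0.
have mNt : measurable ((fun x : n.-tuple R => tuple_snoc (x, t)) @^-1` N).
  by rewrite -[X in measurable X]setTI; exact: measurable_snoc_section.
exists ((fun x => tuple_snoc (x, t)) @^-1` N); split => //.
  move: Nt0; rewrite -[X in _ = X -> _]/0%E => <-.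
  by rewrite -[in LHS](setIT (_ @^-1` _)) -integral_indic//; exact: eq_integral.
by move=> x /= Px; exact: PN.
Qed.

End lebesgue_tuple_fubini.

(** * Symmetry of the sections of a kernel *)

Lemma tuple_snoc_lift_perm (R : realType) n (s : 'S_n) (x : n.-tuple R)
    (t : R) :
  [tuple tnth (tuple_snoc (x, t)) (lift_perm ord_max ord_max s i)
    | i < n.+1] =
  tuple_snoc ([tuple tnth x (s i) | i < n], t).
Proof.
apply: eq_from_tnth => i; rewrite tnth_mktuple.
have snocE (y : n.-tuple R) :
    (forall j, tnth (tuple_snoc (y, t)) (lift ord_max j) = tnth y j) /\
    tnth (tuple_snoc (y, t)) ord_max = t.
  split => [j|]; rewrite !(tnth_nth 0)/= nth_rcons size_tuple.
    have -> : bump n j = j by rewrite /bump leqNgt ltn_ord.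
    by rewrite ltn_ord.
  by rewrite ltnn eqxx.
case: (unliftP ord_max i) => [j ->|->].
  by rewrite lift_perm_lift !(snocE _).1 tnth_mktuple.
by rewrite lift_perm_id !(snocE _).2.
Qed.

(** Only the permutations of [n+1] variables that fix the last one are used:
    these are the ones that act on the section at a fixed [t]. *)
Lemma symmetric_kernel_section (R : realType) n (f : n.+1.-tuple R -> R) :
  symmetric_kernel f ->
  {ae lebesgue_measure, forall t : R,
     symmetric_kernel (fun x : n.-tuple R => f (tuple_snoc (x, t)))}.
Proof.
move=> symf; apply: (@filter_forall _ _ _ _ (ae_filter_ringOfSetsType _)) => s.
have := ae_lebesgue_tupleS (symf (lift_perm ord_max ord_max s)).
apply: (@filterS _ _ (ae_filter_ringOfSetsType _)) => t.
by apply: filterS => x; rewrite tuple_snoc_lift_perm.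
Qed.

(** * Weighted norms of chaos series *)

Lemma Lnorm2_sqr d (T : measurableType d) (R : realType)
    (mu : {measure set T -> \bar R}) (f : T -> R) :
  ('N[mu]_2%:E [EFin \o f] ^+ 2 = \int[mu]_x (f x ^+ 2)%:E)%E.
Proof.
have -> : ('N[mu]_2%:E [EFin \o f] ^+ 2 = 'N[mu]_2%:E [EFin \o f] `^ 2)%E.
  have := Lnorm_ge0 mu 2%:E (EFin \o f).
  case: ('N[mu]_2%:E[_])%E => [r||] // r0.
    by rewrite poweR_EFin powR_mulrn// EFin_expe.
  by rewrite poweRyr.
rewrite poweR_Lnorm//; apply: eq_integral => x _ /=.
by rewrite powR_mulrn// real_normK// num_real.
Qed.

Section stochastic_derivative.
Context {R : realType}.
Implicit Types (l e t : R) (Phi : chaos_series R).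

Definition chaos_weight l n : R := n`!%:R * expR (2 * l * n%:R).

Lemma chaos_weight_gt0 l n : 0 < chaos_weight l n.
Proof. by rewrite mulr_gt0 ?expR_gt0// ltr0n fact_gt0. Qed.

Lemma calG_norm2E l Phi :
  calG_norm2 l Phi = (\sum_(0 <= n <oo)
    (chaos_weight l n)%:E *
    \int[lebesgue_tuple n]_x ((Phi n x) ^+ 2)%:E)%E.
Proof. by apply: eq_eseriesr => n _; rewrite Lnorm2_sqr. Qed.

Lemma sqr_integral_ge0 d (T : measurableType d)
    (mu : {measure set T -> \bar R}) (f : T -> R) :
  (0 <= \int[mu]_x (f x ^+ 2)%:E)%E.
Proof. by apply: integral_ge0 => x _; rewrite lee_fin sqr_ge0. Qed.

Lemma calG_term_ge0 l Phi n :
  (0 <= (chaos_weight l n)%:E * \int[lebesgue_tuple n]_x ((Phi n x) ^+ 2)%:E)%E.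
Proof.
by rewrite mule_ge0 ?sqr_integral_ge0// lee_fin ltW ?chaos_weight_gt0.
Qed.

Lemma calG_norm2_ge0 l Phi : (0 <= calG_norm2 l Phi)%E.
Proof.
by rewrite calG_norm2E; apply: nneseries_ge0 => n _ _; exact: calG_term_ge0.
Qed.

(** The factor [1 + 1 / (2 e)] bounds [(n+1) exp(- 2 e n)], and
    [exp(- 2 l)] compensates the shift of the chaos order by one. *)
Definition deriv_const l e : R := (1 + (2 * e)^-1) * expR (- (2 * l)).

Lemma deriv_const_ge0 l e : 0 < e -> 0 <= deriv_const l e.
Proof.
by move=> e0; rewrite mulr_ge0 ?expR_ge0// addr_ge0// invr_ge0 mulr_ge0// ltW.
Qed.

(** With [y = 2 e n], one has
    [n + 1 <= (1 + 1 / (2 e)) (1 + y) <= (1 + 1 / (2 e)) exp(y)]. *)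
Lemma chaos_weight_deriv_le l e n : 0 < e ->
  chaos_weight (l - e) n * n.+1%:R ^+ 2 <=
  deriv_const l e * chaos_weight l n.+1.
Proof.
move=> e0; rewrite /chaos_weight /deriv_const factS natrM.
have n0 : 0 <= n%:R :> R by [].
have -> : (1 + (2 * e)^-1) * expR (- (2 * l)) *
    (n.+1%:R * n`!%:R * expR (2 * l * n.+1%:R)) =
    (1 + (2 * e)^-1) * (n.+1%:R * n`!%:R) * expR (2 * l * n%:R) :> R.
  rewrite [RHS](_ : _ = (1 + (2 * e)^-1) * (n.+1%:R * n`!%:R) *
    (expR (- (2 * l)) * expR (2 * l * n.+1%:R))); first by ring.
  by rewrite -expRD; congr (_ * expR _); rewrite -natr1; ring.
have -> : expR (2 * (l - e) * n%:R) =
    expR (2 * l * n%:R) * expR (- (2 * e * n%:R)) :> R.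
  by rewrite -expRD; congr expR; ring.
have -> : n`!%:R * (expR (2 * l * n%:R) * expR (- (2 * e * n%:R))) *
      n.+1%:R ^+ 2 =
    (n.+1%:R * expR (- (2 * e * n%:R))) *
      (n.+1%:R * n`!%:R * expR (2 * l * n%:R)) :> R.
  by ring.
rewrite -[leRHS]mulrA; apply: ler_wpM2r; first by rewrite !mulr_ge0 ?expR_ge0.
rewrite expRN ler_pdivrMr ?expR_gt0//.
apply: le_trans (ler_wpM2l _ (expR_ge1Dx _)); last first.
  by rewrite addr_ge0 ?invr_ge0 ?mulr_ge0 ?ltW.
rewrite -natr1 mulrDl mul1r mulrDr mulr1 mulrA mulVf ?mul1r; last first.
  by rewrite mulf_neq0// gt_eqF.
have : 0 <= (2 * e)^-1 by rewrite invr_ge0 mulr_ge0 ?ltW.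
have : 0 <= 2 * e * n%:R by rewrite !mulr_ge0// ltW.
lra.
Qed.

(** * The integral estimate for the stochastic derivative *)

Definition measurable_kernels Phi : Prop :=
  forall n, measurable_fun setT (Phi n).

Lemma calG_measurable l Phi : calG l Phi -> measurable_kernels Phi.
Proof. by move=> [+ _] n => /(_ n)[/sub_Lfun_mfun]; rewrite inE. Qed.

Lemma measurable_sqr_kernel Phi n : measurable_kernels Phi ->
  measurable_fun setT (fun x => (Phi n x ^+ 2)%:E).
Proof.
by move=> mPhi; apply/measurable_EFinP; exact: (measurable_funX 2 (mPhi n)).
Qed.

Lemma sqr_integral_stoch_deriv Phi t n : measurable_kernels Phi ->
  (\int[lebesgue_tuple n]_x (stoch_deriv t Phi x ^+ 2)%:E =
   (n.+1%:R ^+ 2)%:E *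
     \int[lebesgue_tuple n]_x (Phi n.+1 (tuple_snoc (x, t)) ^+ 2)%:E)%E.
Proof.
move=> mPhi; rewrite -ge0_integralZl_EFin ?sqr_ge0//.
- by apply: eq_integral => x _; rewrite /stoch_deriv exprMn EFinM.
- by move=> x _; rewrite lee_fin sqr_ge0.
- exact: (measurableT_comp (measurable_sqr_kernel mPhi)
    (@measurable_snoc_section R n t)).
Qed.

Lemma measurable_sqr_integral_stoch_deriv Phi n : measurable_kernels Phi ->
  measurable_fun setT (fun t : measurableTypeR R =>
    \int[lebesgue_tuple n]_x (stoch_deriv t Phi x ^+ 2)%:E)%E.
Proof.
move=> mPhi; under eq_fun do rewrite (sqr_integral_stoch_deriv _ _ mPhi).
apply: measurable_funeM.
apply: (measurable_integral_snoc (measurable_sqr_kernel mPhi)) => x.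
by rewrite lee_fin sqr_ge0.
Qed.

Lemma measurable_calG_norm2_stoch_deriv l Phi : measurable_kernels Phi ->
  measurable_fun setT (fun t : measurableTypeR R =>
    calG_norm2 l (stoch_deriv t Phi)).
Proof.
move=> mPhi; under eq_fun do rewrite calG_norm2E.
apply: ge0_emeasurable_sum => [n t _ _|n _]; first exact: calG_term_ge0.
by apply: measurable_funeM; exact: measurable_sqr_integral_stoch_deriv.
Qed.

Lemma integral_calG_term_stoch_deriv l Phi n : measurable_kernels Phi ->
  (\int[lebesgue_measure]_t ((chaos_weight l n)%:E *
     \int[lebesgue_tuple n]_x (stoch_deriv t Phi x ^+ 2)%:E) =
   (chaos_weight l n * n.+1%:R ^+ 2)%:E *
     \int[lebesgue_tuple n.+1]_x (Phi n.+1 x ^+ 2)%:E)%E.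
Proof.
move=> mPhi.
have sq0 x : (0 <= (Phi n.+1 x ^+ 2)%:E)%E by rewrite lee_fin sqr_ge0.
under eq_integral do rewrite (sqr_integral_stoch_deriv _ _ mPhi) muleA -EFinM.
rewrite (integral_lebesgue_tupleS (measurable_sqr_kernel mPhi) sq0).
rewrite ge0_integralZl_EFin//.
- by move=> t _; exact: integral_ge0.
- exact: (measurable_integral_snoc (measurable_sqr_kernel mPhi) sq0).
- by rewrite mulr_ge0 ?sqr_ge0// ltW ?chaos_weight_gt0.
Qed.

Lemma integral_calG_norm2_stoch_deriv_le l e Phi :
  measurable_kernels Phi -> 0 < e ->
  (\int[lebesgue_measure]_t calG_norm2 (l - e) (stoch_deriv t Phi) <=
   (deriv_const l e)%:E * calG_norm2 l Phi)%E.
Proof.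
move=> mPhi e0; under eq_integral do rewrite calG_norm2E.
rewrite integral_nneseries//; last 2 first.
- move=> n; apply: measurable_funeM.
  exact: measurable_sqr_integral_stoch_deriv.
- by move=> n t _; exact: calG_term_ge0.
have C0 : 0 <= deriv_const l e := deriv_const_ge0 l e0.
rewrite calG_norm2E -nneseriesZl; last by move=> n _; exact: calG_term_ge0.
set u := (X in (_ <= \sum_(0 <= n <oo) X n)%E).
have u0 n : (0 <= u n)%E by rewrite mule_ge0 ?lee_fin ?calG_term_ge0.
(* the derivative does not see the kernel of order 0, whose term is dropped *)
apply: (@le_trans _ _ (\sum_(0 <= n <oo) u n.+1)%E); last first.
  rewrite [leRHS](nneseries_split 0 1)// add0n -nneseries_addn//.
  under [X in (_ <= _ + X)%E]eq_eseriesr do rewrite addn1.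
  by rewrite leeDr// sume_ge0.
apply: lee_nneseries => n _.
  by move=> _; apply: integral_ge0 => t _; exact: calG_term_ge0.
rewrite integral_calG_term_stoch_deriv// /u muleA -EFinM.
by rewrite lee_wpmul2r ?sqr_integral_ge0// lee_fin chaos_weight_deriv_le.
Qed.

(** * Almost every derivative lies in the weighted space *)

Lemma calG_norm2_kernel_lty l Phi n : (calG_norm2 l Phi < +oo)%E ->
  (\int[lebesgue_tuple n]_x (Phi n x ^+ 2)%:E < +oo)%E.
Proof.
rewrite calG_norm2E => Phioo.
have w0 := chaos_weight_gt0 l n.
have := @nneseries_lim_ge R _ xpredT 0%N n.+1
  (fun n _ _ => calG_term_ge0 l Phi n).
rewrite big_nat_recr//= => /le_lt_trans/(_ Phioo) Soo.
rewrite -(@lte_pmul2l R (chaos_weight l n)%:E) ?lte_fin//.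
rewrite gt0_muley ?lte_fin//.
apply: le_lt_trans Soo; rewrite leeDr// sume_ge0// => k _; exact: calG_term_ge0.
Qed.

Lemma calG_stoch_deriv l Phi t :
  measurable_kernels Phi ->
  (forall n, symmetric_kernel
     (fun x : n.-tuple R => Phi n.+1 (tuple_snoc (x, t)))) ->
  (calG_norm2 l (stoch_deriv t Phi) < +oo)%E ->
  calG l (stoch_deriv t Phi).
Proof.
move=> mPhi symPhi Doo; split => // n; split; last first.
  by move=> s; apply: filterS (symPhi n s) => x; rewrite /stoch_deriv => ->.
rewrite inE; apply/andP; split.
  rewrite inE; apply: measurable_funM => //.
  by apply: measurableT_comp (mPhi n.+1) _; exact: measurable_snoc_section.
rewrite inE /= /finite_norm.
have := calG_norm2_kernel_lty n Doo; rewrite -Lnorm2_sqr.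
have := Lnorm_ge0 (lebesgue_tuple n) 2%:E (EFin \o @stoch_deriv R t Phi n).
by case: ('N[_]_2%:E[_])%E => [r||]// _ _; rewrite ltry.
Qed.

Lemma ae_calG_stoch_deriv l e Phi : 0 < e -> calG l Phi ->
  {ae lebesgue_measure, forall t, calG (l - e) (stoch_deriv t Phi)}.
Proof.
move=> e0 GPhi; have mPhi := calG_measurable GPhi.
have [Psym Poo] := GPhi.
have sym : {ae lebesgue_measure, forall t n,
    symmetric_kernel (fun x : n.-tuple R => Phi n.+1 (tuple_snoc (x, t)))}.
  apply: ae_foralln => n; apply: symmetric_kernel_section.
  by have [] := Psym n.+1.
have Doo : {ae lebesgue_measure, forall t : R,
    (calG_norm2 (l - e) (stoch_deriv t Phi) < +oo)%E}.
  have iD : lebesgue_measure.-integrable setT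
      (fun t : measurableTypeR R => calG_norm2 (l - e) (stoch_deriv t Phi)).
    apply/integrableP; split; first exact: measurable_calG_norm2_stoch_deriv.
    under eq_integral do rewrite gee0_abs ?calG_norm2_ge0//.
    apply: (@le_lt_trans _ _ ((deriv_const l e)%:E * calG_norm2 l Phi)%E).
      exact: integral_calG_norm2_stoch_deriv_le.
    by apply: lte_mul_pinfty; rewrite ?lee_fin ?deriv_const_ge0.
  have := integrable_ae measurableT iD.
  apply: (@filterS _ _ (ae_filter_ringOfSetsType _)) => t /(_ I).
  by rewrite ge0_fin_numE ?calG_norm2_ge0.
apply: (@filterS2 _ _ (ae_filter_ringOfSetsType _)) sym Doo => t symt Dt.
exact: calG_stoch_deriv.
Qed.

End stochastic_derivative.

Theorem theorem3p2 (R : realType) :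
  (forall Phi : chaos_series R, calG_dual Phi ->
     {ae lebesgue_measure, forall t : R, calG_dual (stoch_deriv t Phi)}) /\
  (forall lambda epsilon : R, 0 < lambda -> 0 < epsilon ->
     exists C : R, forall Phi : chaos_series R, calG (- lambda) Phi ->
       [/\ measurable_fun [set: R] (fun t : R =>
             calG_norm2 (- lambda - epsilon) (stoch_deriv t Phi)),
           (\int[lebesgue_measure]_t
               calG_norm2 (- lambda - epsilon) (stoch_deriv t Phi)
             <= C%:E * calG_norm2 (- lambda) Phi)%E,
           (C%:E * calG_norm2 (- lambda) Phi < +oo)%E &
           {ae lebesgue_measure, forall t : R,
              calG (- lambda - epsilon) (stoch_deriv t Phi)}]).
Proof.
split=> [Phi [l l0 GPhi]|l e l0 e0].
  have := ae_calG_stoch_deriv ltr01 GPhi.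
  apply: (@filterS _ _ (ae_filter_ringOfSetsType _)) => t Gt.
  by exists (l + 1); rewrite /= ?addr_gt0// opprD.
exists (deriv_const (- l) e) => Phi GPhi.
have mPhi := calG_measurable GPhi.
split.
- exact: measurable_calG_norm2_stoch_deriv.
- exact: integral_calG_norm2_stoch_deriv_le.
- by apply: lte_mul_pinfty; rewrite ?lee_fin ?deriv_const_ge0//; exact: GPhi.2.
- exact: ae_calG_stoch_deriv.
Qed.
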